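(* Let $\gamma=p_{35}\circ p_{52}\circ p_{24}\circ p_{41}\circ p_{13}$. For every word $W$ in the letters $X_{34},X_{45},X_{24},X_{12},X_{23}$, with dual bar symbol $\omega_W$, one has $$C_{5,W,KZ}=\int_\gamma\mathrm{Reg}(\omega_W,\gamma),$$ where $C_{5,W,KZ}$ is the coefficient of the word $W$ in the free non-commutative expansion of $$\Phi_{KZ}(X_{12},X_{23})\,\Phi_{KZ}(X_{34},X_{45})\,\Phi_{KZ}(X_{23}+X_{24}+X_{34},X_{12})\,\Phi_{KZ}(X_{23},X_{34})\,\Phi_{KZ}(X_{45},X_{23}+X_{24}+X_{34})\in\mathbb C\langle\langle X_{34},X_{45},X_{24},X_{12},X_{23}\rangle\rangle .$$
   Context: **Drinfel'd associator.** $(\zeta^{sh}(W))_{W\in\{X_0,X_1\}^*}$ are the shuffle-regularized multiple zeta values: $\zeta^{sh}(X_0)=\zeta^{sh}(X_1)=0$; $\zeta^{sh}(X_0^{k_1-1}X_1\cdots X_0^{k_p-1}X_1)=\sum_{n_1>\cdots>n_p>0}n_1^{-k_1}\cdots n_p^{-k_p}$ if $k_1\ge2$; and $\zeta^{sh}(V)\zeta^{sh}(W)=\sum_U\zeta^{sh}(U)$ over all shuffles $U$ of $V,W$ (with multiplicity); $\zeta^{sh}(\emptyset)=1$. With $\mathrm{dp}(W)$ the number of letters $X_1$ in $W$, the Drinfel'd associator is $\Phi_{KZ}(X_0,X_1)=\sum_W(-1)^{\mathrm{dp}(W)}\zeta^{sh}(W)W$, and $\Phi_{KZ}(A,B)$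 denotes the substitution $X_0\mapsto A,X_1\mapsto B$. **Geometry.** $\mathcal M_{0,5}=\{(x,y)\in(\mathbb P^1)^2: x,y\ne0,1,\infty,\ xy\neq1\}$ (the point $(x,y)$ being the class of $(z_1,\ldots,z_5)=(0,xy,y,1,\infty)$), with dihedral coordinates $u_{ij}=u_{ji}$: $u_{25}=x$, $u_{35}=y$, $u_{14}=1-xy$, $u_{13}=\frac{1-x}{1-xy}$, $u_{24}=\frac{1-y}{1-xy}$. The forms $d\log u_{ij}$ are a basis of $H^1_{dR}(\mathcal M_{0,5})$. Put $\omega_{12}=d\log u_{25}$, $\omega_{23}=d\log(u_{13}u_{14})$, $\omega_{34}=d\log(u_{24}u_{14})$, $\omega_{45}=d\log u_{35}$, $\omega_{24}=d\log u_{14}$. For $W=X_{i_nj_n}\cdots X_{i_1j_1}$, $\omega_W=[\omega_{i_nj_n}|\cdots|\omega_{i_1j_1}]\in H^1_{dR}(\mathcal M_{0,5})^{\otimes n}$. **Boundary, paths, regularization.** In the partial compactification $\mathcal M_{0,5}^\delta$ (on which the $u_{ij}$ are regular functions), let $D_{ij}=D_{ji}$ be the divisor $u_{ij}=0$, and $P_3=D_{35}\cap D_{13}$, $P_1=D_{13}\cap D_{41}$, $P_4=D_{41}\cap D_{24}$, $P_2=D_{24}\cap D_{52}$, $P_5=D_{52}\cap D_{35}$. On $D_{ij}$ the two coordinates $u_{kl}$ whose chord crosses the chord $(i,j)$ of the pentagon are identically $1$; the remaining two restrict to functions $t,1-t$. For $j\equiv i-2\bmod5$, $p_{ji}$ is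 the real segment in $D_{ji}$ going from $P_i$ to $P_j$; choose the coordinate $t$ on $D_{ji}$ with $t=0$ at $P_i$, $t=1$ at $P_j$. $\mathrm{Reg}(\cdot,D_{ij})$ is the linear map sending $d\log u_{kl}$ to $0$ if $u_{kl}|_{D_{ij}}$ is identically $0$ or $1$, and to $d\log(u_{kl}|_{D_{ij}})$ otherwise, extended to tensors slotwise. The regularized iterated integral $\int_{p_{ji}}$ on words in $\frac{dt}{t},\frac{dt}{t-1}$ is the shuffle-regularized integral over $0<t_1<\cdots<t_n<1$ of $[\nu_n|\cdots|\nu_1]\mapsto\nu_1(t_1)\wedge\cdots\wedge\nu_n(t_n)$: it equals this convergent integral if $\nu_n=\frac{dt}t$ and $\nu_1=\frac{dt}{t-1}$, vanishes on the single forms $\frac{dt}t,\frac{dt}{t-1}$, and is multiplicative for the shuffle product. Composition: $\beta\circ\alpha$ means first $\alpha$ then $\beta$, and for $\gamma=p_{35}\circ p_{52}\circ p_{24}\circ p_{41}\circ p_{13}$, $\int_\gamma\mathrm{Reg}(\omega_W,\gamma)=\sum_{U_1\cdots U_5=W}\int_{p_{35}}\mathrm{Reg}(\omega_{U_1},D_{35})\int_{p_{52}}\mathrm{Reg}(\omega_{U_2},D_{52})\int_{p_{24}}\mathrm{Reg}(\omega_{U_3},D_{24})\int_{p_{41}}\mathrm{Reg}(\omega_{U_4},D_{41})\int_{p_{13}}\mathrm{Reg}(\omega_{U_5},D_{13})$, the $U_i$ being possibly empty words. *)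

(* Defs.v *)
From HB Require Import structures.
From mathcomp Require Import all_boot all_order all_algebra.
From mathcomp Require Import complex.
From mathcomp Require Import all_classical all_reals all_analysis.
From mathcomp Require Import ring.

Set Implicit Arguments.
Unset Strict Implicit.
Unset Printing Implicit Defensive.

Import Order.TTheory GRing.Theory Num.Theory.
Import numFieldNormedType.Exports.

Local Open Scope classical_set_scope.
Local Open Scope ring_scope.

(* Words are sequences of letters, read from left to right. The two-letter
   alphabet is bool; it serves both for {X_0, X_1} and for {dt/t, dt/(t-1)}. *)
Definition X0 : bool := false.
Definition X1 : bool := true.

(* All the shuffles of two words, with multiplicity. *)
Fixpoint shuffle (T : Type) (s t : seq T) {struct s} : seq (seq T) :=
  match s with
  | [::] => [:: t]
  | x :: s' =>
    (fix shuffle_s (t : seq T) : seq (seq T) :=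
       match t with
       | [::] => [:: s]
       | y :: t' => [seq x :: u | u <- shuffle s' t]
                    ++ [seq y :: u | u <- shuffle_s t']
       end) t
  end.

Definition shuffle_multiplicative (R : pzSemiRingType) (f : seq bool -> R) :=
  forall V W, f V * f W = \sum_(U <- shuffle V W) f U.

Section MultipleZetaValues.
Variable R : realType.

(* The sum of n_1^{-k_1} ... n_p^{-k_p} over N > n_1 > ... > n_p > 0. *)
Fixpoint mzv_trunc (k : seq nat) (N : nat) : R :=
  if k is k1 :: k' then \sum_(1 <= n < N) n%:R ^- k1 * mzv_trunc k' n else 1.

(* X_0^{k_1-1} X_1 ... X_0^{k_p-1} X_1 *)
Definition mzv_word (k : seq nat) : seq bool :=
  flatten [seq rcons (nseq k_i.-1 X0) X1 | k_i <- k].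

(* Exactly one function satisfies these conditions. *)
Record is_shuffle_mzv (zsh : seq bool -> R) : Prop := {
  zsh_nil : zsh [::] = 1;
  zsh_X0 : zsh [:: X0] = 0;
  zsh_X1 : zsh [:: X1] = 0;
  zsh_mzv : forall (k1 : nat) (k : seq nat),
    (2 <= k1)%N -> all (leq 1) k ->
    mzv_trunc (k1 :: k) N @[N --> \oo] --> zsh (mzv_word (k1 :: k));
  zsh_shuffle : shuffle_multiplicative zsh
}.

Definition form01 (b : bool) (t : R) : R := if b then (t - 1)^-1 else t^-1.

(* The integral of nu_1(t_1) ... nu_n(t_n) over 0 < t_1 < ... < t_n < s, for
   the word [nu_n | ... | nu_1]: the outermost variable t_n carries the first
   letter. *)
Fixpoint iterated_integral (w : seq bool) (s : R) : R :=
  if w is b :: w' then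
    \int[lebesgue_measure]_(t in `]0, s[) (form01 b t * iterated_integral w' t)
  else 1.

(* Exactly one function satisfies these conditions. *)
Record is_regularized_integral (int01 : seq bool -> R) : Prop := {
  int01_nil : int01 [::] = 1;
  int01_dlog0 : int01 [:: X0] = 0;
  int01_dlog1 : int01 [:: X1] = 0;
  int01_convergent : forall w : seq bool,
    int01 (X0 :: rcons w X1) = iterated_integral (X0 :: rcons w X1) 1;
  int01_shuffle : shuffle_multiplicative int01
}.

End MultipleZetaValues.

Variant letter := X12 | X23 | X24 | X34 | X45.

Definition letter_code (l : letter) : nat :=
  match l with X12 => 0 | X23 => 1 | X24 => 2 | X34 => 3 | X45 => 4 end.
Definition letter_decode (n : nat) : option letter :=
  nth None [:: Some X12; Some X23; Some X24; Some X34; Some X45] n.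
Lemma letter_codeK : pcancel letter_code letter_decode.
Proof. by case. Qed.
HB.instance Definition _ := Countable.copy letter (pcan_type letter_codeK).
Lemma letter_enumP : Finite.axiom [:: X12; X23; X24; X34; X45].
Proof. by case. Qed.
HB.instance Definition _ := fintype.isFinite.Build letter letter_enumP.

(* Non-commutative formal power series over K, given by their coefficients. *)
Section NonCommutativeSeries.
Variables (K : pzRingType) (A : eqType).

Definition ncseries := seq A -> K.
Definition nc1 : ncseries := fun w => (w == [::])%:R.
Definition ncX (a : A) : ncseries := fun w => (w == [:: a])%:R.
Definition ncadd (f g : ncseries) : ncseries := fun w => f w + g w.
Definition ncmul (f g : ncseries) : ncseries :=
  fun w => \sum_(i < (size w).+1) f (take i w) * g (drop i w).

(* The image of the word V under X_0 |-> a, X_1 |-> b. *)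
Definition nc_eval_word (a b : ncseries) (V : seq bool) : ncseries :=
  foldr (fun e f => ncmul (if e then b else a) f) nc1 V.

(* The substitution phi(a, b) for a and b without constant term: only the
   finitely many words V with size V <= size w can contribute to the
   coefficient of w. *)
Definition nc_subst (phi : seq bool -> K) (a b : ncseries) : ncseries :=
  fun w => \sum_(V : {bseq (size w) of bool}) phi V * nc_eval_word a b V w.

End NonCommutativeSeries.

Section Associator.
Variables (R : realType) (zsh : seq bool -> R).
Local Notation C := (complex R).

Definition Phi_KZ_coef (W : seq bool) : C :=
  real_complex R ((-1) ^+ count_mem X1 W * zsh W).

Definition Phi_KZ (a b : ncseries C letter) : ncseries C letter :=
  nc_subst Phi_KZ_coef a b.

Definition X_ (l : letter) : ncseries C letter := ncX C l.
Definition X23_24_34 : ncseries C letter := ncadd (ncadd (X_ X23) (X_ X24)) (X_ X34).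

Definition C5_KZ : ncseries C letter :=
  ncmul (Phi_KZ (X_ X12) (X_ X23))
 (ncmul (Phi_KZ (X_ X34) (X_ X45))
 (ncmul (Phi_KZ X23_24_34 (X_ X12))
 (ncmul (Phi_KZ (X_ X23) (X_ X34))
        (Phi_KZ (X_ X45) X23_24_34)))).

End Associator.

(* The chords {i, j} of the pentagon with vertices 1, ..., 5. *)
Variant chord := c13 | c14 | c24 | c25 | c35.

Definition ends (c : chord) : nat * nat :=
  match c with
  | c13 => (1, 3) | c14 => (1, 4) | c24 => (2, 4) | c25 => (2, 5) | c35 => (3, 5)
  end%N.
Definition chord_decode (e : nat * nat) : option chord :=
  match e with
  | (1, 3) => Some c13 | (1, 4) => Some c14 | (2, 4) => Some c24
  | (2, 5) => Some c25 | (3, 5) => Some c35 | _ => None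
  end%N.
Lemma endsK : pcancel ends chord_decode.
Proof. by case. Qed.
HB.instance Definition _ := Countable.copy chord (pcan_type endsK).
Lemma chord_enumP : Finite.axiom [:: c13; c14; c24; c25; c35].
Proof. by case. Qed.
HB.instance Definition _ := fintype.isFinite.Build chord chord_enumP.

Definition incident (v : nat) (c : chord) : bool :=
  (v == (ends c).1) || (v == (ends c).2).

Definition crosses (c d : chord) : bool :=
  let: (i, j) := ends c in
  let: (k, l) := ends d in
  [&& i < k, k < j & j < l]%N || [&& k < i, i < l & l < j]%N.

(* The segment p_{ji} in D_{ji}, j = i - 2 mod 5, goes from P_i to P_j;
   path_src is i and path_tgt is j. *)
Definition path_src (c : chord) : nat :=
  match c with c13 => 3 | c14 => 1 | c24 => 4 | c25 => 2 | c35 => 5 end%N.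
Definition path_tgt (c : chord) : nat :=
  match c with c13 => 1 | c14 => 4 | c24 => 2 | c25 => 5 | c35 => 3 end%N.

Lemma path_srcE c v : incident v c -> v != path_tgt c -> v = path_src c.
Proof. by case: c => /orP[] /eqP->. Qed.

Lemma path_tgt_mod5 c : path_src c = path_tgt c + 2 %[mod 5].
Proof. by case: c. Qed.

(* p_{35} o p_{52} o p_{24} o p_{41} o p_{13}, the last path first *)
Definition gamma : seq chord := [:: c35; c25; c24; c14; c13].

Lemma gamma_composable : sorted (fun c d => path_src c == path_tgt d) gamma.
Proof. by []. Qed.

(* The n-th tensor power of K^A, in its standard basis. *)
Notation tensor K A n := {ffun n.-tuple A -> K}.

Section Geometry.
Variable C : fieldType.

Definition M05 : set (C * C) :=
  [set p | [/\ p.1 != 0, p.1 != 1, p.2 != 0, p.2 != 1 & p.1 * p.2 != 1]].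

Definition dihedral (p : C * C) (c : chord) : C :=
  let: (x, y) := p in
  match c with
  | c25 => x
  | c35 => y
  | c14 => 1 - x * y
  | c13 => (1 - x) / (1 - x * y)
  | c24 => (1 - y) / (1 - x * y)
  end.

(* The points of M_{0,5}^delta, in dihedral coordinates. *)
Definition M05delta : set (chord -> C) :=
  [set u | forall c, u c + \prod_(d : chord | crosses c d) u d = 1].

Definition divisor (c : chord) : set (chord -> C) := M05delta `&` [set u | u c = 0].

(* P_v is the intersection of the two divisors whose chords end at v. *)
Definition corner (v : nat) : set (chord -> C) :=
  M05delta `&` [set u | forall d, incident v d -> u d = 0].

(* The restriction of u_d to D_c, as a polynomial in the coordinate t of D_c
   with t = 0 at P_(path_src c) and t = 1 at P_(path_tgt c); see divisorE,
   corner_src and corner_tgt. *)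
Definition restr (c d : chord) : {poly C} :=
  if d == c then 0
  else if crosses c d then 1
  else if incident (path_src c) d then 'X
  else 1 - 'X.

Lemma big_chord (P : pred chord) (F : chord -> C) :
  \prod_(d | P d) F d = \prod_(d <- [:: c13; c14; c24; c25; c35] | P d) F d.
Proof.
apply: perm_big; apply: uniq_perm; rewrite ?index_enum_uniq //.
by move=> d; rewrite mem_index_enum; case: d.
Qed.

Lemma M05deltaP u :
  M05delta u <-> [/\ u c13 + u c24 * u c25 = 1, u c14 + u c25 * u c35 = 1,
                     u c24 + u c13 * u c35 = 1, u c25 + u c13 * u c14 = 1 &
                     u c35 + u c14 * u c24 = 1].
Proof.
have E c : u c + \prod_(d | crosses c d) u d =
  match c with
  | c13 => u c13 + u c24 * u c25 | c14 => u c14 + u c25 * u c35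
  | c24 => u c24 + u c13 * u c35 | c25 => u c25 + u c13 * u c14
  | c35 => u c35 + u c14 * u c24
  end.
  by rewrite big_chord !big_cons big_nil; case: c; rewrite /crosses /= !mulr1.
rewrite /M05delta /=; split=> [H|[H1 H2 H3 H4 H5] c]; last by rewrite E; case: c.
by split; [have := H c13|have := H c14|have := H c24|have := H c25|have := H c35];
   rewrite E.
Qed.

Lemma M05delta_interior :
  M05delta `&` [set u | forall c, u c != 0] = dihedral @` M05.
Proof.
apply/seteqP; split=> u.
  move=> [/M05deltaP[E13 E14 E24 E25 E35] nz].
  have e14 : u c14 = 1 - u c25 * u c35 by rewrite -E14 addrK.
  have e13 : 1 - u c25 = u c13 * u c14 by rewrite -E25 addrC addKr.
  have e24 : 1 - u c35 = u c14 * u c24 by rewrite -E35 addrC addKr.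
  exists (u c25, u c35).
    split=> //=.
    - by rewrite eq_sym -subr_eq0 e13 mulf_neq0.
    - by rewrite eq_sym -subr_eq0 e24 mulf_neq0.
    - by rewrite eq_sym -subr_eq0 -e14.
  apply/funext; case=> //=; rewrite -e14 ?e13 ?e24 //.
    by rewrite mulfK.
  by rewrite mulrC mulKf.
move=> [[x y]] [/= x0 x1 y0 y1 xy1] <-.
have xy : 1 - x * y != 0 by rewrite subr_eq0 eq_sym.
have xx : 1 - x != 0 by rewrite subr_eq0 eq_sym.
have yy : 1 - y != 0 by rewrite subr_eq0 eq_sym.
split; last by case=> //=; rewrite mulf_neq0 // invr_neq0.
by apply/M05deltaP; split=> /=; field.
Qed.

Lemma divisorE c : divisor c = range (fun (t : C) d => (restr c d).[t]).
Proof.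
apply/seteqP; split=> u.
  move=> [/M05deltaP[E13 E14 E24 E25 E35] /= u0].
  exists (u (match c with c13 => c35 | c14 => c13 | c24 => c14
                        | c25 => c24 | c35 => c25 end)) => //.
  have solve (a b w : C) : w = 1 -> a + w * b = 1 -> a = 1 - b.
    by move=> -> <-; rewrite mul1r addrK.
  apply/funext => d; case: c u0 => u0; move: E13 E14 E24 E25 E35;
    rewrite u0 ?(mul0r, mulr0, add0r, addr0) => E13 E14 E24 E25 E35;
    case: d; rewrite /restr /= ?hornerE //; apply/esym.
  - exact: solve E25 E14.
  - by apply: solve E35 _; rewrite mulrC.
  - exact: solve E13 E25.
  - exact: solve E14 E35.
  - exact: solve E24 E13.
move=> [t _ <-]; split; last by rewrite /= /restr eqxx horner0.
by apply/M05deltaP; case: c; split; rewrite /restr /= !hornerE;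
  first [by ring | by rewrite /= addrC addKr | by rewrite /= addrAC subrr add0r].
Qed.

Lemma corner_src c : corner (path_src c) (fun d => (restr c d).[0]).
Proof.
have [Mc _] : divisor c (fun d => (restr c d).[0]) by rewrite divisorE; exists 0.
by split=> //= d; case: c {Mc}; case: d => //=; rewrite /restr /= hornerE.
Qed.

Lemma corner_tgt c : corner (path_tgt c) (fun d => (restr c d).[1]).
Proof.
have [Mc _] : divisor c (fun d => (restr c d).[1]) by rewrite divisorE; exists 1.
by split=> //= d; case: c {Mc}; case: d => //=; rewrite /restr /= !hornerE ?subrr.
Qed.

(* [v_1 | ... | v_n] *)
Definition bar (A : finType) (n : nat) (v : n.-tuple {ffun A -> C}) : tensor C A n :=
  [ffun J : n.-tuple A => \prod_(k < n) tnth v k (tnth J k)].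

(* H^1_dR(M_{0,5}) in its basis of the d log u_c. *)
Definition H1dR := {ffun chord -> C}.
Definition dlog_u (c : chord) : H1dR := [ffun d => (d == c)%:R].

Definition omega (l : letter) : H1dR :=
  match l with
  | X12 => dlog_u c25
  | X23 => dlog_u c13 + dlog_u c14
  | X34 => dlog_u c24 + dlog_u c14
  | X45 => dlog_u c35
  | X24 => dlog_u c14
  end.

Definition omega_word (W : seq letter) : tensor C chord (size W) :=
  bar (map_tuple omega (in_tuple W)).

(* The forms a dt/t + b dt/(t-1), in the basis dt/t (false), dt/(t-1) (true). *)
Definition forms01 := {ffun bool -> C}.

(* For f = const * t^a * (t-1)^b, d log f = a dt/t + b dt/(t-1). *)
Definition dlog (f : {poly C}) : forms01 :=
  [ffun b : bool => (if b then mup 1 f else mup 0 f)%:R].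

Definition restricts_to (c d : chord) (a : C) := forall u, divisor c u -> u d = a.

(* Reg(d log u_d, D_c); if u_d is neither 0 nor 1 on D_c, it is t or 1 - t. *)
Definition reg_dlog (c d : chord) : forms01 :=
  if `[< restricts_to c d 0 \/ restricts_to c d 1 >] then 0 else dlog (restr c d).

(* The linear extension of reg_dlog c, applied in each slot. *)
Definition Reg (n : nat) (c : chord) (T : tensor C chord n) : tensor C bool n :=
  [ffun w => \sum_(J : n.-tuple chord) T J * bar (map_tuple (reg_dlog c) J) w].

End Geometry.

Section RegularizedIntegrals.
Variables (R : realType) (int01 : seq bool -> R).
Local Notation C := (complex R).

(* The linear extension of int01 to tensors. The segment p_{ji} is 0 < t < 1
   in the coordinate t of D_{ji}, so this is the regularized integral along
   each of the five segments. *)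
Definition segment_integral (n : nat) (T : tensor C bool n) : C :=
  \sum_(w : n.-tuple bool) T w * real_complex R (int01 w).

(* The integral along a composite g_1 o ... o g_m: the sum over all factorizations
   W = U_1 ... U_m of the products of the integrals along g_k of Reg(omega_(U_k)). *)
Definition path_integral (g : seq chord) (W : seq letter) : C :=
  \sum_(U : (size g).-tuple {bseq (size W) of letter}
          | flatten [seq bseqval U_k | U_k <- U] == W)
    \prod_(k < size g)
      segment_integral (Reg (tnth (in_tuple g) k) (omega_word C (tnth U k))).

End RegularizedIntegrals.

(* Main.v *)
Require Import Defs.
From mathcomp Require Import all_boot all_algebra complex all_reals.
From mathcomp Require Import all_order all_classical all_analysis measurable_realfun ring.

Set Implicit Arguments.
Unset Strict Implicit.
Unset Printing Implicit Defensive.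

Import Order.TTheory GRing.Theory Num.Theory.
Import numFieldNormedType.Exports.

Local Open Scope classical_set_scope.
Local Open Scope ring_scope.

(** Both sides multiply five factors, one for each side of the pentagon, over
    the factorizations of W ([sum_factorizations]); so it is enough to match
    them side by side ([segment_integral_Phi_KZ]).

    On the divisor of the chord c each form omega_l restricts to a multiple
    [reg_omega c l false] of dt/t plus a multiple [reg_omega c l true] of
    dt/(t-1). Hence the generating series over all words of the regularized
    integrals along this segment is the series with coefficients [int01] in
    two variables, evaluated at the linear forms sum_l (reg_omega c l e) X_l
    ([nc_subst_linear], [Reg_omega_word]). Reading off the restrictions of the
    u_d to D_c shows that these linear forms are exactly the arguments of the
    corresponding factor Phi_KZ ([nclinear_reg_omega]).

    There remains the comparison of coefficients,
    int01 w = (-1)^dp(w) zsh w ([regularized_integral_mzv]). A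
    shuffle-multiplicative function that vanishes on letters is determined by
    its values on the words X0 ... X1 ([shuffle_multiplicative_uniq]), since
    shuffling one more letter X1 into the front, or X0 into the back, of a word
    expresses the divergent words through less divergent ones. On the
    convergent words the identity is Kontsevich's formula: up to sign, the
    iterated integral with upper bound s is the multiple polylogarithm
    ([iterated_integral_sgn_cons]). Each integration step is the termwise
    integration of a power series with nonnegative coefficients, so monotone
    convergence applies up to and including s = 1, and the partial sums of the
    series at s = 1 are truncated multiple zeta sums
    ([sum_polylog_coef_mzv]). *)

(** * Uniqueness of the shuffle regularization *)

Lemma shuffle_letter_cons (T : Type) (x y : T) (v : seq T) :
  shuffle [:: x] (y :: v) = [:: x, y & v] :: [seq y :: u | u <- shuffle [:: x] v].
Proof. by []. Qed.

Lemma shuffle_cons (T : Type) (x y : T) (s t : seq T) :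
  shuffle (x :: s) (y :: t) =
  [seq x :: u | u <- shuffle s (y :: t)] ++ [seq y :: u | u <- shuffle (x :: s) t].
Proof. by []. Qed.

Lemma count_shuffle (T : eqType) (p : pred T) (s t u : seq T) :
  u \in shuffle s t -> count p u = (count p s + count p t)%N.
Proof.
elim: s t u => [|x s IHs] t u; first by rewrite inE => /eqP->.
elim: t u => [|y t IHt] u; first by rewrite inE => /eqP->; rewrite addn0.
rewrite shuffle_cons mem_cat => /orP[] /mapP[v hv ->] /=.
- by rewrite (IHs _ _ hv) /= addnA.
- by rewrite (IHt _ hv) /= addnCA.
Qed.

(** Shuffling in one letter means inserting it at every position, which does
    not depend on the reading direction; statements about the front of words
    thereby transfer to their back. *)
Lemma shuffle_letter_rev (T : eqType) (x : T) (v : seq T) :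
  perm_eq (shuffle [:: x] (rev v)) [seq rev u | u <- shuffle [:: x] v].
Proof.
have rconsE y w : perm_eq (shuffle [:: x] (rcons w y))
    (rcons (rcons w y) x :: [seq rcons u y | u <- shuffle [:: x] w]).
  elim: w => [|z w IHw]; first by rewrite /= (perm_catC [:: _] [:: _]).
  rewrite rcons_cons shuffle_letter_cons.
  have /(perm_map (cons z)) := IHw; rewrite /= -(perm_cons [:: x, z & rcons w y]).
  move/perm_trans; apply.
  rewrite (perm_catCA [:: _] [:: _]) /= !perm_cons -!map_comp.
  by apply/permP => p; congr count; apply: eq_map.
elim: v => [|y v IHv] //.
rewrite rev_cons; apply: (perm_trans (rconsE _ _)); rewrite shuffle_letter_cons /=.
rewrite !rev_cons perm_cons.
have /(perm_map (fun u => rcons u y))/perm_trans := IHv; apply.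
rewrite -!map_comp; apply/permP => p; congr count; apply: eq_map => u /=.
by rewrite rev_cons.
Qed.

Section Uniqueness.
Variable (R : numFieldType).

(** Inserting x into the leading block of a letters x gives the same word
    a + 1 times; every other insertion leaves that block as it is. *)
Lemma sum_shuffle_letter (x y : bool) (a : nat) (v : seq bool) (F : seq bool -> R) :
  \sum_(U <- shuffle [:: x] (nseq a x ++ y :: v)) F U =
  F (nseq a.+1 x ++ y :: v) *+ a.+1 +
  \sum_(u <- shuffle [:: x] v) F (nseq a x ++ y :: u).
Proof.
elim: a F => [|a IHa] F.
  by rewrite shuffle_letter_cons big_cons big_map.
rewrite [nseq a.+1 x ++ _]/= shuffle_letter_cons big_cons big_map IHa.
by rewrite addrA -mulrS.
Qed.

Lemma sum_shuffle_nseq (x : bool) (a : nat) (F : seq bool -> R) :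
  \sum_(U <- shuffle [:: x] (nseq a x)) F U = F (nseq a.+1 x) *+ a.+1.
Proof.
elim: a F => [|a IHa] F; first by rewrite big_seq1.
by rewrite [nseq a.+1 x]/= shuffle_letter_cons big_cons big_map IHa -mulrS.
Qed.

(** What shuffle multiplicativity says about a difference h of two
    multiplicative functions that vanish on the letter x: contrary to
    multiplicativity, this condition is linear in h. *)
Definition shuffle_orthogonal (h : seq bool -> R) (x : bool) :=
  forall W, \sum_(U <- shuffle [:: x] W) h U = 0.

Lemma shuffle_orthogonal_nseq h x a :
  shuffle_orthogonal h x -> h (nseq a.+1 x) = 0.
Proof.
by move=> /(_ (nseq a x)); rewrite sum_shuffle_nseq => /eqP; rewrite mulrn_eq0 => /eqP.
Qed.

(** Induction on the length a of the leading block: shuffling x into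
    [nseq a x ++ y :: v] expresses the value at the word with a longer block
    through words with the shorter one, and a + 1 is invertible. *)
Lemma shuffle_orthogonal_leading h x y (P : pred (seq bool)) a v :
    shuffle_orthogonal h x ->
    (forall v u, P v -> u \in shuffle [:: x] v -> P u) ->
    (forall v, P v -> h (y :: v) = 0) ->
  P v -> h (nseq a x ++ y :: v) = 0.
Proof.
move=> h0 Pstable hP; elim: a v => [|a IHa] v Pv; first exact: hP.
have := h0 (nseq a x ++ y :: v); rewrite sum_shuffle_letter big_seq big1 ?addr0.
  by move/eqP; rewrite mulrn_eq0 => /eqP.
by move=> u uv; apply: IHa; apply: Pstable uv.
Qed.

Lemma shuffle_orthogonal_rev h x :
  shuffle_orthogonal h x -> shuffle_orthogonal (h \o rev) x.
Proof.
move=> h0 W; transitivity (\sum_(U <- shuffle [:: x] (rev W)) h U); last exact: h0.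
by rewrite (perm_big _ (shuffle_letter_rev x W)) big_map.
Qed.

Lemma leading_letterP (x : bool) (w : seq bool) :
  exists a, w = nseq a x \/ exists v, w = nseq a x ++ ~~ x :: v.
Proof.
elim: w => [|y w [a aP]]; first by exists 0%N; left.
have [->|nyx] := eqVneq y x.
  by exists a.+1; case: aP => [->|[v ->]]; [left|right; exists v].
exists 0%N; right; exists w; congr cons.
by move: nyx; case: y; case: x {aP}.
Qed.

(** The leading letters X1 of words that end with X1 are removed first; then,
    reading backwards, the trailing letters X0 of arbitrary words. *)
Lemma shuffle_orthogonal_eq0 h :
    shuffle_orthogonal h X0 -> shuffle_orthogonal h X1 ->
    h [::] = 0 -> (forall w, h (X0 :: rcons w X1) = 0) ->
  forall w, h w = 0.
Proof.
move=> h0 h1 hnil hconv.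
have endX1 w : h (rcons w X1) = 0.
  have [a [wE|[v wE]]] := leading_letterP X1 w.
    by rewrite wE -cats1 -(nseqD a 1) addn1 shuffle_orthogonal_nseq.
  (* Ending with X1 survives the insertion of a letter X1, even at the end. *)
  pose P u := if u is b :: u' then last b u' == X1 else false.
  rewrite wE rcons_cat rcons_cons.
  apply: (@shuffle_orthogonal_leading h X1 X0 P) => //.
  - move=> v1 u; elim: v1 u => [|b v1 IHv] u //.
    rewrite shuffle_letter_cons /P => bv.
    rewrite inE => /orP[/eqP->//|/mapP[[|c u'] + ->]] //.
      by move=> /(count_shuffle predT).
    case: v1 => [|b1 v1] in IHv bv *; first by rewrite inE => /eqP[-> ->].
    by move=> /IHv; apply.
  - by case/lastP=> // u b; case: u => [|c u] /=; rewrite ?last_rcons => /eqP->;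
      [exact: (hconv [::])|exact: (hconv (c :: u))].
  - by case: v {wE} => [|b v] //=; rewrite last_rcons.
move=> w; rewrite -[w]revK.
have [a [wE|[v wE]]] := leading_letterP X0 (rev w).
  by case: a wE => [->//|a ->]; exact: (shuffle_orthogonal_nseq a (shuffle_orthogonal_rev h0)).
rewrite wE; apply: (@shuffle_orthogonal_leading (h \o rev) X0 X1 predT) => //.
  exact: shuffle_orthogonal_rev.
by move=> u _ /=; rewrite rev_cons.
Qed.

Lemma shuffle_multiplicative_uniq (f g : seq bool -> R) :
    shuffle_multiplicative f -> shuffle_multiplicative g ->
    f [::] = g [::] -> (forall b, f [:: b] = 0) -> (forall b, g [:: b] = 0) ->
    (forall w, f (X0 :: rcons w X1) = g (X0 :: rcons w X1)) ->
  f =1 g.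
Proof.
move=> fM gM fg0 f1 g1 fg w; apply/eqP; rewrite -subr_eq0; apply/eqP.
have h0 b : shuffle_orthogonal (fun w => f w - g w) b.
  by move=> W; rewrite sumrB -fM -gM f1 g1 !mul0r subrr.
apply: (@shuffle_orthogonal_eq0 (fun w => f w - g w)) => // [|u].
  by rewrite fg0 subrr.
by rewrite fg subrr.
Qed.

Lemma shuffle_multiplicative_sign (f : seq bool -> R) :
  shuffle_multiplicative f ->
  shuffle_multiplicative (fun w => (-1) ^+ count_mem X1 w * f w).
Proof.
move=> fM V W; rewrite mulrACA -exprD fM mulr_sumr !big_seq; apply: eq_bigr => U.
by move=> /count_shuffle->.
Qed.

End Uniqueness.

(** * Iterated integrals as power series *)

Section PowerSeries.
Variable R : realType.
Local Notation mu := (@lebesgue_measure R).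

(** The coefficient of s^n in the multiple polylogarithm Li_w(s), where
    Li_(X0 w)(s) is the integral of Li_w(t) dt/t and Li_(X1 w)(s) that of
    Li_w(t) dt/(1-t) over 0 < t < s. As 0^-1 = 0, the constant term vanishes
    for nonempty w. *)
Fixpoint polylog_coef (w : seq bool) (n : nat) : R :=
  if w is b :: w' then
    (if b then \sum_(m < n) polylog_coef w' m else polylog_coef w' n) / n%:R
  else (n == 0%N)%:R.

Lemma polylog_coef_cons0 b w : polylog_coef (b :: w) 0 = 0.
Proof. by rewrite /= invr0 mulr0. Qed.

Lemma polylog_coef_ge0 w n : 0 <= polylog_coef w n.
Proof.
elim: w n => [|b w IHw] n; first exact: ler0n.
by rewrite /= divr_ge0 //; case: b => //; apply: sumr_ge0.
Qed.

Lemma polylog_term_ge0 w n s : 0 <= s -> 0 <= polylog_coef w n * s ^+ n.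
Proof. by move=> s0; rewrite (mulr_ge0 (polylog_coef_ge0 _ _)) // exprn_ge0. Qed.

(** This crude bound makes the series converge for s < 1. *)
Lemma polylog_coef_le1 w n : polylog_coef w n <= 1.
Proof.
elim: w n => [|b w IHw] n; first by rewrite /= lern1 leq_b1.
case: n => [|n]; first by rewrite polylog_coef_cons0.
rewrite /= ler_pdivrMr ?ltr0n // mul1r; case: b.
  by rewrite (le_trans (ler_sum _ (fun (m : 'I_n.+1) _ => IHw m))) // sumr_const card_ord.
by rewrite (le_trans (IHw _)) // ler1n.
Qed.

Lemma integral_exprn (n : nat) (s : R) : 0 < s ->
  (\int[mu]_(t in `]0%R, s[) (n.+1%:R * t ^+ n)%:E = (s ^+ n.+1)%:E)%E.
Proof.
move=> s0.
have cf : continuous (fun t : R => n.+1%:R * t ^+ n).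
  by move=> t; apply: cvgM; [exact: cvg_cst|exact: exprn_continuous].
have mf (D : set R) : measurable D ->
    measurable_fun D (fun t : R => (n.+1%:R * t ^+ n)%:E).
  move=> mD; apply/measurable_EFinP; apply: measurable_funS (measurableT) _ _ => //.
  exact: continuous_measurable_fun.
rewrite integral_itv_obnd_cbnd ?integral_itv_bndo_bndc; try exact: mf.
rewrite (@continuous_FTC2 _ _ (fun t => t ^+ n.+1)) //.
- by rewrite expr0n sube0.
- exact: continuous_subspaceT.
- split.
  + by move=> x _; exact: exprn_derivable.
  + exact/cvg_at_right_filter/exprn_continuous.
  + exact/cvg_at_left_filter/exprn_continuous.
- by move=> x _; rewrite derive1E exp_derive scaler1 scaler_nat mulr_natl.
Qed.

Lemma nneseries_exprn (t : R) : 0 <= t -> t < 1 ->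
  (\sum_(0 <= n <oo) (t ^+ n)%:E = ((1 - t)^-1)%:E)%E.
Proof.
move=> t0 t1; apply: cvg_lim => //.
rewrite (_ : (fun N => _) = EFin \o series (geometric 1 t)); last first.
  apply/funext => N /=; rewrite sumEFin /series /=; congr EFin.
  by apply: eq_bigr => n _; rewrite mul1r.
apply: cvg_EFin; first by near=> N.
rewrite -[(1 - t)^-1]div1r; apply: cvg_geometric_series.
by rewrite ger0_norm.
Unshelve. all: by end_near. Qed.

(** Multiplication by 1/(1-t) replaces the coefficients by their partial sums:
    expand 1/(1-t) as a geometric series and exchange the two summations. *)
Lemma nneseries_divB1 (c : nat -> R) (t : R) :
    0 <= t -> t < 1 -> (forall n, 0 <= c n) ->
  (((1 - t)^-1)%:E * \sum_(0 <= n <oo) (c n * t ^+ n)%:E =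
  \sum_(0 <= n <oo) ((\sum_(m < n.+1) c m) * t ^+ n)%:E)%E.
Proof.
move=> t0 t1 c0.
(* a m n is the contribution of c m t^m times t^(n - m). *)
pose a m n : \bar R := if (m <= n)%N then (c m * t ^+ n)%:E else 0%E.
have a0 m n : (0 <= a m n)%E.
  by rewrite /a; case: ifP => // _; rewrite lee_fin mulr_ge0 ?exprn_ge0.
have aE n : (\sum_(0 <= m <oo) a m n = ((\sum_(m < n.+1) c m) * t ^+ n)%:E)%E.
  rewrite (nneseries_split 0 n.+1) // add0n eseries0 ?adde0; last first.
    by move=> m nm _; rewrite /a leqNgt nm.
  rewrite big_mkord mulr_suml -sumEFin; apply: eq_bigr => m _.
  by rewrite /a -ltnS ltn_ord.
transitivity (\sum_(0 <= m <oo) \sum_(0 <= n <oo) a m n)%E; last first.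
  by rewrite nneseries_interchange //; apply: eq_eseriesr => n _.
rewrite -nneseriesZl; last by move=> n _; rewrite lee_fin mulr_ge0 ?exprn_ge0.
apply: eq_eseriesr => m _.
rewrite (nneseries_split 0 m) // add0n big1_seq ?add0e; last first.
  by move=> n /andP[_]; rewrite mem_index_iota => /= nm; rewrite /a leqNgt nm.
rewrite -nneseries_addn // muleC -nneseries_exprn // -nneseriesZl; last first.
  by move=> n _; rewrite lee_fin exprn_ge0.
by apply: eq_eseriesr => n _; rewrite /a leq_addl -EFinM exprD mulrCA mulrC mulrA.
Qed.

Lemma nneseries_divX (c : nat -> R) (t : R) :
    0 < t -> (forall n, 0 <= c n) -> c 0%N = 0 ->
  (t^-1%:E * \sum_(0 <= n <oo) (c n * t ^+ n)%:E =
  \sum_(0 <= n <oo) (c n.+1 * t ^+ n)%:E)%E.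
Proof.
move=> t0 cge0 c0; have tge0 := ltW t0.
rewrite -nneseriesZl; last by move=> n _; rewrite lee_fin mulr_ge0 ?exprn_ge0.
rewrite nneseries_recl //; last first.
  by move=> n _; rewrite lee_fin !mulr_ge0 ?exprn_ge0 ?invr_ge0.
rewrite c0 mul0r mule0 add0e -nneseries_addn; last first.
  by move=> n; rewrite lee_fin !mulr_ge0 ?exprn_ge0 ?invr_ge0.
apply: eq_eseriesr => n _; rewrite addn1 -EFinM exprS; congr EFin.
by field; rewrite gt_eqF.
Qed.

(** The sign makes all integrands nonnegative: each letter X1 contributes
    dt/(t-1) = - dt/(1-t). *)
Definition iterated_integral_sgn (w : seq bool) (s : R) : R :=
  (-1) ^+ count_mem X1 w * iterated_integral w s.

Definition has_polylog_series (w : seq bool) := forall s : R, 0 < s -> s < 1 ->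
  ((iterated_integral_sgn w s)%:E =
   \sum_(0 <= n <oo) (polylog_coef w n * s ^+ n)%:E)%E.

(** The factor n + 1 is the one that the integration of t^n removes. *)
Lemma polylog_integrand_series b w (t : R) : 0 < t -> t < 1 ->
    has_polylog_series w -> (b = X0 -> polylog_coef w 0 = 0) ->
  ((`|form01 b t| * iterated_integral_sgn w t)%:E =
   \sum_(0 <= n <oo) (polylog_coef (b :: w) n.+1 * (n.+1%:R * t ^+ n))%:E)%E.
Proof.
move=> t0 t1 wE w0; rewrite EFinM wE //; have tge0 := ltW t0.
have cE n : polylog_coef (b :: w) n.+1 * (n.+1%:R * t ^+ n) =
    (if b then \sum_(m < n.+1) polylog_coef w m else polylog_coef w n.+1) * t ^+ n.
  by rewrite [polylog_coef]lock /= -lock mulrA divfK.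
rewrite [RHS](eq_eseriesr (fun n _ => congr1 EFin (cE n))).
case: b w0 {cE} => [_|/(_ erefl) w0] /=; last first.
  by rewrite ger0_norm ?invr_ge0 // nneseries_divX // => n; exact: polylog_coef_ge0.
rewrite -nneseries_divB1 // => [|n]; last exact: polylog_coef_ge0.
by rewrite normfV distrC ger0_norm // subr_ge0 ltW.
Qed.

Lemma Rintegral_sign (D : set R) (g : R -> R) (k : nat) :
    (forall t, D t -> 0 <= g t) ->
  \int[mu]_(t in D) ((-1) ^+ k * g t) = (-1) ^+ k * \int[mu]_(t in D) g t.
Proof.
move=> g0; rewrite -signr_odd; case: (odd k); last first.
  by rewrite mul1r; apply: eq_Rintegral => t _; rewrite mul1r.
rewrite expr1 mulN1r /Rintegral -fineN; congr fine.
rewrite -integral_ge0N; last by move=> t /g0; rewrite lee_fin.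
by apply: eq_integral => t _; rewrite mulN1r.
Qed.

(** Termwise integration, by monotone convergence. The series may diverge at
    s = 1; both sides then take the default value of [fine]. *)
Lemma iterated_integral_sgn_cons b w (s : R) : 0 < s -> s <= 1 ->
    has_polylog_series w -> (b = X0 -> polylog_coef w 0 = 0) ->
  iterated_integral_sgn (b :: w) s =
  fine (\sum_(0 <= n <oo) (polylog_coef (b :: w) n * s ^+ n)%:E)%E.
Proof.
move=> s0 s1 wE w0.
have inD (t : R) : `]0, s[%classic t -> 0 < t /\ t < 1.
  by rewrite /= in_itv /= => /andP[-> ts]; split=> //; apply: lt_le_trans ts s1.
pose g t := `|form01 b t| * iterated_integral_sgn w t.
have gE t : 0 < t -> t < 1 ->
    (g t)%:E = (\sum_(0 <= n <oo)
      (polylog_coef (b :: w) n.+1 * (n.+1%:R * t ^+ n))%:E)%E.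
  by move=> t0 t1; exact: polylog_integrand_series.
have term_ge0 n t : 0 < t -> 0 <= polylog_coef (b :: w) n.+1 * (n.+1%:R * t ^+ n).
  by move=> t0; rewrite (mulr_ge0 (polylog_coef_ge0 _ _)) // mulr_ge0 ?exprn_ge0 ?ltW.
have form01E t : 0 < t -> t < 1 -> form01 b t = (-1) ^+ (b == X1) * `|form01 b t|.
  move=> t0 t1; case: b {w0 g gE term_ge0} => /=.
    by rewrite ltr0_norm ?invr_lt0 ?subr_lt0 // expr1 mulN1r opprK.
  by rewrite mul1r gtr0_norm // invr_gt0.
have -> : iterated_integral_sgn (b :: w) s = \int[mu]_(t in `]0, s[) g t.
  transitivity ((-1) ^+ count_mem X1 (b :: w) *
      \int[mu]_(t in `]0, s[) ((-1) ^+ count_mem X1 (b :: w) * g t)).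
    rewrite /iterated_integral_sgn [iterated_integral _ _]/=; congr (_ * _).
    apply: eq_Rintegral => t; rewrite inE => /inD[t0 t1].
    rewrite {1}form01E // /g /iterated_integral_sgn /= exprD -!mulrA.
    congr (_ * _); rewrite [RHS]mulrCA; congr (_ * _).
    by rewrite mulrA -expr2 sqrr_sign mul1r.
  rewrite Rintegral_sign; first by rewrite mulrA -expr2 sqrr_sign mul1r.
  move=> t /inD[t0 t1]; rewrite -lee_fin gE //.
  by apply: nneseries_ge0 => n _ _; rewrite lee_fin term_ge0.
rewrite /Rintegral; congr fine.
transitivity (\int[mu]_(t in `]0%R, s[) \sum_(0 <= n <oo)
      (polylog_coef (b :: w) n.+1 * (n.+1%:R * t ^+ n))%:E)%E.
  by apply: eq_integral => t; rewrite inE => /inD[t0 t1]; exact: gE.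
have mf (n : nat) : measurable_fun `]0, s[ (fun t : R => (n.+1%:R * t ^+ n)%:E).
  apply/measurable_EFinP; apply: measurable_funTS.
  apply: continuous_measurable_fun => t.
  by apply: cvgM; [exact: cvg_cst|exact: exprn_continuous].
rewrite integral_nneseries //; last first.
- by move=> n t /inD[t0 _]; rewrite lee_fin term_ge0.
- by move=> n; exact: (measurable_funeM (polylog_coef (b :: w) n.+1)%:E (mf n)).
rewrite [RHS]nneseries_recl //; last first.
  by move=> n _; rewrite lee_fin polylog_term_ge0 ?ltW.
rewrite polylog_coef_cons0 mul0r add0e -[RHS]nneseries_addn; last first.
  by move=> n; rewrite lee_fin polylog_term_ge0 ?ltW.
apply: eq_eseriesr => n _; rewrite addn1 EFinM.
under eq_integral do rewrite EFinM.
rewrite ge0_integralZl_EFin ?polylog_coef_ge0 ?integral_exprn //.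
- by move=> t /inD[t0 _]; rewrite lee_fin mulr_ge0 ?exprn_ge0 ?ltW.
- exact: mf.
Qed.

(** The condition on w holds for the empty word and for the words that end
    with X1. It makes the integrands regular at t = 0. *)
Lemma polylog_series w : last X1 w = X1 -> has_polylog_series w.
Proof.
elim: w => [_|b w IHw bw] s s0 s1.
  have -> : iterated_integral_sgn [::] s = 1 by rewrite /iterated_integral_sgn /= mulr1.
  rewrite nneseries_recl //; last by move=> n _; rewrite lee_fin polylog_term_ge0 ?ltW.
  rewrite eseries0 ?adde0 => [|[//|n] _ _]; rewrite /= ?mul0r //.
  by rewrite expr0 mulr1.
have w0 : b = X0 -> polylog_coef w 0 = 0.
  by case: w bw {IHw} => [/= -> //|b' w _ _]; exact: polylog_coef_cons0.
have wE : has_polylog_series w by apply: IHw; case: (w) bw.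
rewrite iterated_integral_sgn_cons ?(ltW s1) // fineK // ge0_fin_numE; last first.
  by apply: nneseries_ge0 => n _ _; rewrite lee_fin polylog_term_ge0 ?ltW.
(* The series is finite by comparison with the geometric series. *)
apply: (@le_lt_trans _ _ (\sum_(0 <= n <oo) (s ^+ n)%:E)%E).
  apply: lee_nneseries => n _ *; rewrite lee_fin.
    by rewrite polylog_term_ge0 ?ltW.
  by rewrite ler_piMl ?polylog_coef_le1 ?exprn_ge0 ?ltW.
by rewrite nneseries_exprn ?ltW // ltry.
Qed.

Lemma iterated_integral_at1 w (l : R) :
    \sum_(0 <= n < N) polylog_coef (X0 :: rcons w X1) n @[N --> \oo] --> l ->
  (-1) ^+ count_mem X1 (X0 :: rcons w X1) * iterated_integral (X0 :: rcons w X1) 1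
    = l.
Proof.
move=> wl; rewrite -[LHS]/(iterated_integral_sgn _ _).
rewrite iterated_integral_sgn_cons //; last first.
- by move=> _; case: w {wl} => [|b w]; exact: polylog_coef_cons0.
- by apply: polylog_series; rewrite last_rcons.
rewrite (_ : (\sum_(0 <= n <oo) _)%E = l%:E) //; apply: cvg_lim => //.
rewrite (_ : (fun N => _) =
    EFin \o (fun N => \sum_(0 <= n < N) polylog_coef (X0 :: rcons w X1) n)).
  by apply: cvg_EFin => //; near=> N.
by apply/funext => N; rewrite /comp -sumEFin; apply: eq_bigr => n _; rewrite expr1n mulr1.
Unshelve. all: by end_near. Qed.

End PowerSeries.

(** * Regularized integrals and multiple zeta values *)

Section MZVWords.
Variable R : realType.

(** One letter X1 followed by j integrations against dt/t: the block of
    letters that stands for the exponent j + 1. *)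
Lemma polylog_coef_block j w n :
  polylog_coef R (rcons (nseq j X0) X1 ++ w) n =
  n%:R ^- j.+1 * \sum_(m < n) polylog_coef R w m.
Proof.
elim: j => [|j IHj]; first by rewrite /= expr1 mulrC.
by rewrite exprSr invfM mulrAC -IHj.
Qed.

(** At N = 0 and empty k the left-hand side is 0 and the right-hand side 1. *)
Lemma sum_polylog_coef_mzv k N : all (leq 1) k -> (0 < N)%N ->
  \sum_(0 <= n < N) polylog_coef R (mzv_word k) n = mzv_trunc R k N.
Proof.
elim: k N => [|k1 k IHk] N /=.
  move=> _; case: N => // N _; rewrite big_nat_recl //= big1_seq ?addr0 //.
move=> /andP[k1_gt0 kP] N0; rewrite big_ltn // polylog_coef_block big_ord0 mulr0 add0r.
apply: eq_big_nat => n /andP[n0 _].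
by rewrite polylog_coef_block prednK // -(IHk n) // big_mkord.
Qed.

Lemma mzv_wordP w : exists k1 k,
  [/\ (1 <= k1)%N, all (leq 1) k & rcons w X1 = mzv_word (k1 :: k)].
Proof.
elim: w => [|b w [k1 [k [k1P kP wE]]]]; first by exists 1%N, [::].
case: b; first by exists 1%N, (k1 :: k); rewrite rcons_cons wE /= k1P.
exists k1.+1, k; split=> //; rewrite rcons_cons wE.
by case: k1 k1P {wE} => // k1 _.
Qed.

(** Kontsevich's formula on the convergent words, extended to all words by
    uniqueness: (-1)^dp is compatible with shuffles because the number of
    letters X1 is additive. *)
Lemma regularized_integral_mzv (zsh int01 : seq bool -> R) :
    is_shuffle_mzv zsh -> is_regularized_integral int01 ->
  forall w, int01 w = (-1) ^+ count_mem X1 w * zsh w.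
Proof.
move=> [z0 zX0 zX1 zmzv zM] [i0 iX0 iX1 iconv iM].
apply: shuffle_multiplicative_uniq => //.
- exact: shuffle_multiplicative_sign.
- by rewrite i0 z0 mulr1.
- by case.
- by case; rewrite ?zX0 ?zX1 mulr0.
move=> w; rewrite iconv.
have [k1 [k [k1P kP wE]]] := mzv_wordP w.
have w0E : X0 :: rcons w X1 = mzv_word (k1.+1 :: k).
  by rewrite wE; case: k1 k1P {wE}.
have /iterated_integral_at1 :
    \sum_(0 <= n < N) polylog_coef R (X0 :: rcons w X1) n @[N --> \oo]
      --> zsh (X0 :: rcons w X1).
  rewrite w0E; apply: cvg_trans (zmzv k1.+1 k k1P kP).
  apply: near_eq_cvg; near=> N; rewrite sum_polylog_coef_mzv //; near: N.
  exact: nbhs_infty_gt.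
by move=> <-; rewrite mulrA -expr2 sqrr_sign mul1r.
Unshelve. all: by end_near. Qed.

End MZVWords.

(** * Products and linear substitutions of non-commutative series *)

Section SeriesProducts.
Variables (K : pzRingType) (A : eqType).
Implicit Types (f g : ncseries K A) (w : seq A).

Lemma ncmul1 f : ncmul f (@nc1 K A) = f.
Proof.
apply/funext => w; rewrite /ncmul big_ord_recr /= take_size drop_size /nc1 eqxx mulr1.
rewrite big1 ?add0r // => i _; rewrite -size_eq0 size_drop subn_eq0 leqNgt ltn_ord.
by rewrite mulr0.
Qed.

End SeriesProducts.

Lemma big_bseq_prefix (K : nmodType) (A : finType) (N : nat) (w : seq A)
    (F : seq A -> K) : (size w <= N)%N ->
  \sum_(U : {bseq N of A} | U == take (size U) w :> seq A) F U =
  \sum_(i < (size w).+1) F (take i w).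
Proof.
move=> wN; pose h (i : 'I_(size w).+1) := insub_bseq N (take i w).
have hE i : h i = take i w :> seq A.
  rewrite /h /insub_bseq val_insubd size_take_min ifT //.
  by rewrite (leq_trans (geq_minr _ _)).
rewrite (reindex_onto h (fun U => inord (size U))) /=; last first.
  move=> U /eqP UE; apply/val_inj; rewrite /= hE inordK -?UE //.
  by rewrite ltnS UE size_take_min geq_minr.
apply: eq_big => [i|i _]; last by rewrite hE.
have le_iw : (i <= size w)%N by rewrite -ltnS.
rewrite hE size_takel // eqxx andTb.
by apply/eqP/val_inj; rewrite inord_val.
Qed.

Lemma big_tuple_cons (K : nmodType) (T : finType) (n : nat) (P : pred (seq T))
    (F : n.+1.-tuple T -> K) :
  \sum_(t : n.+1.-tuple T | P t) F t =
  \sum_(x : T) \sum_(t : n.-tuple T | P (x :: t)) F [tuple of x :: t].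
Proof.
rewrite pair_big_dep /= (reindex (fun p : T * n.-tuple T => [tuple of p.1 :: p.2])) /=.
  by apply: eq_bigl => -[x t].
exists (fun t => (thead t, [tuple of behead t])) => [[x t] _|t _] /=.
  by rewrite theadE; congr pair; apply: val_inj.
by rewrite -tuple_eta.
Qed.

(** The words U_k of a factorization of w are at most as long as w, so the bound
    N on their length does not restrict the sum; letting it be independent of w
    allows the induction, which passes to suffixes of w. *)
Lemma sum_factorizations (K : pzRingType) (A : finType) (I : Type) (g : seq I)
    (F : I -> seq A -> K) (N : nat) (w : seq A) : (size w <= N)%N ->
  \sum_(U : (size g).-tuple {bseq N of A} | flatten [seq bseqval U_k | U_k <- U] == w)
    \prod_(k < size g) F (tnth (in_tuple g) k) (tnth U k) =
  foldr (fun c => ncmul (F c)) (@nc1 K A) g w.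
Proof.
elim: g w => [|c g IHg] w wN.
  under eq_bigr do rewrite big_ord0.
  rewrite (eq_bigl (fun=> w == [::])) => [|U]; last by rewrite (tuple0 U) /= eq_sym.
  rewrite /= /nc1; case: (w == [::]); last by rewrite big_pred0_eq.
  by rewrite sumr_const card_tuple expn0.
rewrite (@big_tuple_cons _ _ _ (fun U => flatten [seq bseqval U_k | U_k <- U] == w)) /=.
pose Q := foldr (fun c => ncmul (F c)) (@nc1 K A) g.
transitivity (\sum_(i < (size w).+1) (fun u => F c u * Q (drop (size u) w)) (take i w));
  last by apply: eq_bigr => i _; rewrite size_takel // -ltnS.
rewrite -(big_bseq_prefix (fun u => F c u * Q (drop (size u) w)) wN).
rewrite [RHS]big_mkcond; apply: eq_bigr => u _ /=.
have catE s : (u ++ s == w) = (val u == take (size u) w) && (s == drop (size u) w).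
  rewrite -{1}[w](cat_take_drop (size u)).
  have [le_uw|lt_wu] := leqP (size u) (size w).
    by rewrite eqseq_cat // size_takel.
  rewrite cat_take_drop take_oversize 1?ltnW //.
  (* u is too long to be a prefix of w. *)
  have nu (s' : seq A) : (u ++ s' == w) = false.
    by apply/eqP => /(congr1 size); rewrite size_cat => /eqP; rewrite gtn_eqF // ltn_addr.
  by rewrite nu -[val u]cats0 nu.
under eq_bigl do rewrite catE; case: eqP => _ /=; last by rewrite big_pred0_eq.
rewrite /Q -IHg; last by rewrite size_drop (leq_trans (leq_subr _ _)).
rewrite mulr_sumr; apply: eq_bigr => U _; rewrite big_ord_recl.
by congr (F _ _ * _); apply: eq_bigr => k _; rewrite /= !(tnth_nth u) ?(tnth_nth c).
Qed.

Section LinearSubstitution.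
Variables (K : pzRingType) (A : finType) (co : A -> bool -> K).

(** The linear form sum_l (co l e) X_l. *)
Definition nclinear (e : bool) : ncseries K A :=
  fun w => if w is [:: l] then co l e else 0.

(** A product of linear forms is homogeneous, of degree the number of factors. *)
Lemma nc_eval_word_linear V w :
  nc_eval_word (nclinear false) (nclinear true) V w =
  if size V == size w then \prod_(p <- zip w V) co p.1 p.2 else 0.
Proof.
elim: V w => [|e V IHV] [|l w] /=; rewrite ?big_nil //.
- by rewrite /ncmul big_ord1 /=; case: e; rewrite mul0r.
(* Only the first letter can be cut off as the factor of degree 1. *)
- rewrite /ncmul 2!big_ord_recl /= take0 drop0 big1 => [|i _].
    by rewrite big_cons /= (IHV w) eqSS; case: e; case: ifP; rewrite ?mul0r ?mulr0 ?add0r ?addr0.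
  by case: e; case: w i => [|l' w] i; rewrite ?mul0r //; case: i.
Qed.

Lemma prod_zip_tuple (n : nat) (w : n.-tuple A) (v : n.-tuple bool) :
  \prod_(p <- zip w v) co p.1 p.2 = \prod_(k < n) co (tnth w k) (tnth v k).
Proof.
rewrite -[zip w v]/(val [tuple of zip w v]) big_tuple; apply: eq_bigr => k _.
have [a b] := (tnth w k, tnth v k).
by rewrite (tnth_nth (a, b)) /= nth_zip ?size_tuple // -!tnth_nth.
Qed.

(** By homogeneity only the words V of the length of w contribute. *)
Lemma nc_subst_linear (phi : seq bool -> K) w :
  nc_subst phi (nclinear false) (nclinear true) w =
  \sum_(v : (size w).-tuple bool)
    phi v * \prod_(k < size w) co (tnth (in_tuple w) k) (tnth v k).
Proof.
rewrite /nc_subst.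
under eq_bigr do rewrite nc_eval_word_linear (fun_if (fun x => _ * x)) mulr0.
rewrite -big_mkcond /= (reindex_onto (@bseq_of_tuple (size w) bool)
  (fun V => insubd [tuple of nseq (size w) false] (V : seq bool))) /=.
  apply: eq_big => [v|v _]; last by rewrite (prod_zip_tuple (in_tuple w)).
  rewrite size_tuple eqxx; apply/eqP/val_inj.
  by rewrite val_insubd /= size_tuple eqxx.
by move=> V /eqP VE; apply/val_inj; rewrite /= val_insubd VE eqxx.
Qed.

End LinearSubstitution.

(** * The five linear substitutions given by the boundary divisors *)

Section RegularizedForms.
Variable C : fieldType.

Lemma bigA_distr_tuple (n : nat) (A : finType) (F : 'I_n -> A -> C) :
  \prod_(k < n) \sum_(a : A) F k a = \sum_(t : n.-tuple A) \prod_(k < n) F k (tnth t k).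
Proof.
rewrite bigA_distr_bigA (reindex (fun t : n.-tuple A => [ffun k => tnth t k])) /=.
  by apply: eq_bigr => t _; apply: eq_bigr => k _; rewrite ffunE.
exists (fun f : {ffun 'I_n -> A} => mktuple f) => [t _|f _].
  by apply: eq_from_tnth => k; rewrite tnth_mktuple ffunE.
by apply/ffunP => k; rewrite ffunE tnth_mktuple.
Qed.

(** If c and d are distinct and do not cross, u_d is t or 1 - t on D_c and so
    takes different values at t = 0 and t = 1. *)
Lemma restricts_toE (c d : chord) :
  restricts_to c d (0 : C) \/ restricts_to c d (1 : C) <-> (d == c) || crosses c d.
Proof.
split=> [|/orP[/eqP->|cd]].
- have const (a : C) : restricts_to c d a -> (restr C c d).[0] = (restr C c d).[1].
    move=> da; have on t : (restr C c d).[t] = a.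
      by apply: (da (fun d => (restr C c d).[t])); rewrite divisorE; exists t.
    by rewrite !on.
  move=> H; have {H const} : (restr C c d).[0] = (restr C c d).[1].
    by case: H => /const.
  rewrite /restr; case: ifP => // _; case: ifP => // _.
  case: ifP => _; rewrite !hornerE => /eqP; last by rewrite subr0 subrr oner_eq0.
  by rewrite eq_sym oner_eq0.
- by left=> u [].
- right=> u; rewrite divisorE => -[t _ <-]; rewrite /restr cd.
  case: eqP => [dc|_]; last by rewrite hornerC.
  by move: cd; rewrite dc; case: (c).
Qed.

Lemma mup_X (a : C) : mup a 'X = (a == 0) :> nat.
Proof.
rewrite -['X]expr1 -['X]subr0 -polyC0 mup_XsubCX eq_sym.
by case: eqP.
Qed.

Lemma mup_1subX (a : C) : mup a (1 - 'X) = (a == 1) :> nat.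
Proof.
have -> : 1 - 'X = (-1)%:P * ('X - 1%:P) ^+ 1 :> {poly C}.
  by rewrite expr1 polyCN mulN1r opprB.
rewrite mupMr ?mup_XsubCX; first by rewrite eq_sym; case: eqP.
by rewrite rootC oppr_eq0 oner_eq0.
Qed.

(** A function u_d that is not constant on D_c is t there if the chord d ends at
    the vertex [path_src c], which gives dt/t (e = false), and 1 - t otherwise,
    which gives dt/(t-1) (e = true). *)
Lemma reg_dlogE (c d : chord) (e : bool) :
  reg_dlog C c d e =
  (~~ ((d == c) || crosses c d) && (e != incident (path_src c) d))%:R.
Proof.
rewrite /reg_dlog; case: asboolP => [/restricts_toE->|ncd]; first by rewrite ffunE.
case: (boolP (_ || _)) ncd => [/restricts_toE //|]; rewrite negb_or => /andP[dc cd] _.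
rewrite ffunE /restr (negPf dc) (negPf cd).
by case: e; case: (incident _ _); rewrite ?mup_X ?mup_1subX ?eqxx ?(eq_sym 0) ?oner_eq0.
Qed.

Definition reg_omega (c : chord) (l : letter) (e : bool) : C :=
  \sum_(d : chord) omega C l d * reg_dlog C c d e.

(** [Reg] acts on each slot separately, so that the sum over all basis tensors is
    a product of sums. *)
Lemma Reg_omega_word (c : chord) (U : seq letter) (v : (size U).-tuple bool) :
  Reg c (omega_word C U) v =
  \prod_(k < size U) reg_omega c (tnth (in_tuple U) k) (tnth v k).
Proof.
rewrite /Reg ffunE bigA_distr_tuple; apply: eq_bigr => J _.
by rewrite !ffunE -big_split; apply: eq_bigr => k _; rewrite !tnth_map.
Qed.

Lemma reg_omegaE (c : chord) (l : letter) (e : bool) :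
  reg_omega c l e =
  match l with
  | X12 => reg_dlog C c c25 e
  | X23 => reg_dlog C c c13 e + reg_dlog C c c14 e
  | X24 => reg_dlog C c c14 e
  | X34 => reg_dlog C c c24 e + reg_dlog C c c14 e
  | X45 => reg_dlog C c c35 e
  end.
Proof.
have dlogE d' : \sum_d dlog_u C d' d * reg_dlog C c d e = reg_dlog C c d' e.
  rewrite (bigD1 d') //= ffunE eqxx mul1r big1 ?addr0 // => d /negPf dd'.
  by rewrite ffunE dd' mul0r.
have dlog2E d1 d2 : \sum_d (dlog_u C d1 + dlog_u C d2) d * reg_dlog C c d e =
    reg_dlog C c d1 e + reg_dlog C c d2 e.
  by rewrite -!dlogE -big_split; apply: eq_bigr => d _; rewrite ffunE mulrDl.
by case: l; rewrite /reg_omega /= ?dlogE ?dlog2E.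
Qed.

(** The two arguments of the factor of the pentagon product that belongs to the
    segment on D_c. *)
Definition path_letters (c : chord) (e : bool) : ncseries C letter :=
  let X l := ncX C l in
  let Y := ncadd (ncadd (X X23) (X X24)) (X X34) in
  match c, e with
  | c35, false => X X12 | c35, true => X X23
  | c25, false => X X34 | c25, true => X X45
  | c24, false => Y     | c24, true => X X12
  | c14, false => X X23 | c14, true => X X34
  | c13, false => X X45 | c13, true => Y
  end.

(** For example, on D_14 only u_13 and u_24 are nonconstant; they are t and
    1 - t, and occur in omega_23 and omega_34 only, so that X0 is replaced by
    X23 and X1 by X34. *)
Lemma nclinear_reg_omega (c : chord) (e : bool) :
  nclinear (reg_omega c) e = path_letters c e.
Proof.
apply/funext => -[|l [|l' w]]; rewrite /nclinear.
- by case: c e => -[]; rewrite /path_letters /ncadd /ncX /= ?mulr0n ?addr0.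
- rewrite reg_omegaE !reg_dlogE.
  by case: c e => -[]; case: l; rewrite /path_letters /ncadd /ncX /= ?mulr0n ?addr0 ?add0r.
- by case: c e => -[]; rewrite /path_letters /ncadd /ncX /= !eqseq_cons /= !andbF ?mulr0n ?addr0.
Qed.

End RegularizedForms.

(** * Integrals along the segments *)

Lemma segment_integral_Phi_KZ (R : realType) (zsh int01 : seq bool -> R) (c : chord) :
    is_shuffle_mzv zsh -> is_regularized_integral int01 ->
  (fun U => segment_integral int01 (Reg c (omega_word (complex R) U))) =
  Phi_KZ zsh (path_letters (complex R) c false) (path_letters (complex R) c true).
Proof.
move=> zshP int01P; apply/funext => U; rewrite -!nclinear_reg_omega /Phi_KZ nc_subst_linear.
apply: eq_bigr => v _; rewrite Reg_omega_word mulrC; congr (_ * _).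
by rewrite /Phi_KZ_coef (regularized_integral_mzv zshP int01P).
Qed.

Theorem proposition3p18 (R : realType)
    (zsh : seq bool -> R) (zshP : is_shuffle_mzv zsh)
    (int01 : seq bool -> R) (int01P : is_regularized_integral int01)
    (W : seq letter) :
  C5_KZ zsh W = path_integral int01 gamma W.
Proof.
pose S c U := segment_integral int01 (Reg c (omega_word (complex R) U)).
have SE : S = fun c => Phi_KZ zsh (path_letters _ c false) (path_letters _ c true).
  by apply/funext => c; apply: segment_integral_Phi_KZ.
transitivity (foldr (fun c => ncmul (S c)) (@nc1 _ _) gamma W); last first.
  by rewrite -(sum_factorizations gamma S (leqnn (size W))).
by rewrite SE /= ncmul1.
Qed.
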